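(* For graphs $G_1,\ldots,G_d$, $$\mathrm{boxicity}\left(\Box_{i=1}^d G_i\right) \leq \mathrm{boxicity}\left(\boxtimes_{i=1}^d G_i\right) + \mathrm{boxicity}\left(\Box_{i=1}^d K_{\chi_i}\right)$$ and $$\mathrm{cubicity}\left(\Box_{i=1}^d G_i\right) \leq \mathrm{cubicity}\left(\boxtimes_{i=1}^d G_i\right) + \mathrm{cubicity}\left(\Box_{i=1}^d K_{\chi_i}\right),$$ where $\chi_i$ denotes the chromatic number of $G_i$, $i\in[d]$.
   Context: All graphs are finite, undirected and simple. $[d]=\{1,\ldots,d\}$ and $K_n$ is the complete graph on $n$ vertices. A $k$-box is a Cartesian product of $k$ closed intervals of $\mathbb{R}$, and a $k$-cube is a Cartesian product of $k$ closed intervals of unit length. A $k$-box ($k$-cube) representation of a graph $G$ is a function $f$ mapping each vertex to a $k$-box ($k$-cube) such that for any two distinct vertices $u,v$, $uv\in E(G)$ if and only if $f(u)\cap f(v)\neq\emptyset$. The boxicity (cubicity) of $G$ is the smallest natural number $k$ (with $0$ allowed; complete graphs have boxicity and cubicity $0$) such that $G$ has a $k$-box ($k$-cube) representation. The following products of $G_1$ and $G_2$ have vertex set $V(G_1)\times V(G_2)$. In the strong product $G_1\boxtimes G_2$, two distinct vertices $(u_1,u_2)$, $(v_1,v_2)$ are adjacent iff ($u_1=v_1$ or $u_1v_1\in E(G_1)$) and ($u_2=v_2$ or $u_2v_2\in E(G_2)$). In the Cartesian product $G_1\Box G_2$, they are adjacent iff ($u_1=v_1$ and $u_2v_2\in E(G_2)$)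 or ($u_1v_1\in E(G_1)$ and $u_2=v_2$). $\boxtimes_{i=1}^d$ and $\Box_{i=1}^d$ denote the iterated products. *)

(* Defs.v *)
From HB Require Import structures.
From mathcomp Require Import all_boot all_order all_algebra.
From mathcomp Require Import boolp classical_sets reals.
From mathcomp Require Import lra.

Set Implicit Arguments.
Unset Strict Implicit.
Unset Printing Implicit Defensive.

Import Order.TTheory GRing.Theory Num.Theory.
Local Open Scope classical_set_scope.
Local Open Scope ring_scope.

Record sgraph := SGraph {
  vertex :> finType;
  edge : rel vertex;
  edge_sym : symmetric edge;
  edge_irrefl : irreflexive edge }.

Section CompleteGraph.
Variable n : nat.

Definition complete_edge : rel 'I_n := fun i j => i != j.

Lemma complete_edge_sym : symmetric complete_edge.
Proof. by move=> i j; rewrite /complete_edge eq_sym. Qed.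

Lemma complete_edge_irrefl : irreflexive complete_edge.
Proof. by move=> i; rewrite /complete_edge eqxx. Qed.

Definition complete_graph : sgraph :=
  SGraph complete_edge_sym complete_edge_irrefl.

End CompleteGraph.

Section Products.
Variables G1 G2 : sgraph.

Definition strong_edge : rel (G1 * G2)%type := fun u v =>
  [&& u != v,
      (u.1 == v.1) || edge u.1 v.1 &
      (u.2 == v.2) || edge u.2 v.2].

Lemma strong_edge_sym : symmetric strong_edge.
Proof.
move=> u v; rewrite /strong_edge (eq_sym u) (eq_sym u.1) (eq_sym u.2).
by rewrite (edge_sym u.1) (edge_sym u.2).
Qed.

Lemma strong_edge_irrefl : irreflexive strong_edge.
Proof. by move=> u; rewrite /strong_edge eqxx. Qed.

Definition strong_product : sgraph :=
  SGraph strong_edge_sym strong_edge_irrefl.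

Definition cartesian_edge : rel (G1 * G2)%type := fun u v =>
  (u.1 == v.1) && edge u.2 v.2 || edge u.1 v.1 && (u.2 == v.2).

Lemma cartesian_edge_sym : symmetric cartesian_edge.
Proof.
move=> u v; rewrite /cartesian_edge (eq_sym u.1) (eq_sym u.2).
by rewrite (edge_sym u.1) (edge_sym u.2).
Qed.

Lemma cartesian_edge_irrefl : irreflexive cartesian_edge.
Proof. by move=> u; rewrite /cartesian_edge !edge_irrefl andbF. Qed.

Definition cartesian_product : sgraph :=
  SGraph cartesian_edge_sym cartesian_edge_irrefl.

End Products.

(* K_1 is, up to isomorphism, the neutral element of both products: the
   iterated product of G_0, ..., G_(d-1) is G_0 x (... x (G_(d-1) x K_1)). *)
Definition strong_iprod (d : nat) (G : 'I_d -> sgraph) : sgraph :=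
  \big[strong_product/complete_graph 1]_(i < d) G i.

Definition cartesian_iprod (d : nat) (G : 'I_d -> sgraph) : sgraph :=
  \big[cartesian_product/complete_graph 1]_(i < d) G i.

Definition colorable (G : sgraph) (k : nat) : bool :=
  [exists c : {ffun G -> 'I_k},
    [forall u, [forall v, edge u v ==> (c u != c v)]]].

Lemma colorable_ex (G : sgraph) : exists k, colorable G k.
Proof.
exists #|G|; apply/existsP; exists [ffun u => enum_rank u].
apply/forallP => u; apply/forallP => v; apply/implyP => uv.
rewrite !ffunE (inj_eq enum_rank_inj).
by apply: contraTneq uv => ->; rewrite edge_irrefl.
Qed.

Definition chromatic_number (G : sgraph) : nat := ex_minn (colorable_ex G).

Section Representations.
Variable R : realType.

(* Intervals are nonempty; for k = 0 the only box and the only cube is the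
   one-point space itself. *)
Definition is_box (k : nat) (B : set ('I_k -> R)) : Prop :=
  exists a b : 'I_k -> R, (forall i, a i <= b i) /\
    B = [set x | forall i, x i \in `[a i, b i]].

Definition is_cube (k : nat) (B : set ('I_k -> R)) : Prop :=
  exists a : 'I_k -> R, B = [set x | forall i, x i \in `[a i, a i + 1]].

Definition represents (G : sgraph) (k : nat) (f : G -> set ('I_k -> R)) : Prop :=
  forall u v : G, u <> v -> (edge u v <-> f u `&` f v !=set0).

Definition box_representable (G : sgraph) (k : nat) : Prop :=
  exists f : G -> set ('I_k -> R), (forall u, is_box (f u)) /\ represents f.

Definition cube_representable (G : sgraph) (k : nat) : Prop :=
  exists f : G -> set ('I_k -> R), (forall u, is_cube (f u)) /\ represents f.

(* One coordinate per vertex w, with w at [0, 1], its neighbours at [1, 2] and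
   its non-neighbours at [3/2, 5/2]. *)
Lemma cube_representable_card (G : sgraph) : cube_representable G #|G|.
Proof.
pose a (u : G) (i : 'I_#|G|) : R :=
  if u == enum_val i then 0 else if edge (enum_val i) u then 1 else 3 / 2.
exists (fun u => [set x | forall i, x i \in `[a u i, a u i + 1]]); split.
  by move=> u; exists (a u).
move=> u v /eqP uv; split=> [e|[x [xu xv]]].
  exists (fun i => Num.max (a u i) (a v i)); split=> i /=;
    rewrite in_itv /= le_max lexx ?orbT /= ge_max; apply/andP; split;
    rewrite /a; case: (u =P enum_val i) => [Eu|_];
    case: (v =P enum_val i) => [Ev|_];
    rewrite -?Eu -?Ev ?e ?(edge_sym v u) ?e; do ?case: ifP => _; lra.
apply: contraT => ne; move: (xu (enum_rank u)) (xv (enum_rank u)).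
rewrite !in_itv /= /a !enum_rankK eqxx eq_sym (negPf uv) (negPf ne).
by move=> /andP[_ h1] /andP[h2 _]; lra.
Qed.

Lemma cube_representable_ex (G : sgraph) :
  exists k, `[< cube_representable G k >].
Proof. by exists #|G|; apply/asboolP/cube_representable_card. Qed.

Lemma box_representable_ex (G : sgraph) :
  exists k, `[< box_representable G k >].
Proof.
exists #|G|; apply/asboolP.
have [f [cf rf]] := cube_representable_card G; exists f; split=> // u.
have [a ->] := cf u; exists a, (fun i => a i + 1); split=> // i; lra.
Qed.

Definition boxicity (G : sgraph) : nat := ex_minn (box_representable_ex G).

Definition cubicity (G : sgraph) : nat := ex_minn (cube_representable_ex G).

End Representations.

(* Main.v *)
Require Import Defs.
From mathcomp Require Import all_boot all_order all_algebra.
From mathcomp Require Import boolp classical_sets reals.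

Set Implicit Arguments.
Unset Strict Implicit.
Unset Printing Implicit Defensive.

Import Order.TTheory GRing.Theory Num.Theory.
Local Open Scope classical_set_scope.
Local Open Scope ring_scope.

(** Colour each factor G_i properly with chi_i colours, and let c be the induced
coordinatewise map to the product of the K_(chi_i). If u and v are adjacent in
the strong product, then c u and c v differ in exactly the coordinates in which
u and v do; hence u and v are adjacent in the Cartesian product iff they are
adjacent in the strong product and c u, c v are adjacent in the Cartesian
product of the K_(chi_i). Taking the product of a representation of the strong
product with the pull-back along c of one of the product of complete graphs
therefore represents the Cartesian product. *)

Lemma chromatic_number_coloring (G : sgraph) :
  exists c : G -> complete_graph (chromatic_number G),
    forall u v, edge u v -> c u != c v.
Proof.
rewrite /chromatic_number; case: ex_minnP => k /existsP[c cP] _.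
by exists c => u v; move/forallP: cP => /(_ u) /forallP /(_ v) /implyP.
Qed.

Section SetJoin.
Variable R : realType.

Definition set_join (m n : nat) (A : set ('I_m -> R)) (B : set ('I_n -> R)) :
    set ('I_(m + n) -> R) :=
  [set x : 'I_(m + n) -> R | A (x \o @lshift m n) /\ B (x \o @rshift m n)].

Definition fun_join (m n : nat) (x : 'I_m -> R) (y : 'I_n -> R)
    (i : 'I_(m + n)) : R :=
  match split i with inl j => x j | inr j => y j end.

Lemma fun_join_lshift m n (x : 'I_m -> R) (y : 'I_n -> R) j :
  fun_join x y (lshift n j) = x j.
Proof. by rewrite /fun_join (unsplitK (inl j)). Qed.

Lemma fun_join_rshift m n (x : 'I_m -> R) (y : 'I_n -> R) j :
  fun_join x y (rshift m j) = y j.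
Proof. by rewrite /fun_join (unsplitK (inr j)). Qed.

(** An intersection of products is the product of the intersections, so a join encodes the
    conjunction of two adjacency conditions. *)
Lemma set_join_meet m n (A A' : set ('I_m -> R)) (B B' : set ('I_n -> R)) :
  set_join A B `&` set_join A' B' !=set0 <->
  A `&` A' !=set0 /\ B `&` B' !=set0.
Proof.
split=> [[x [[Ax Bx] [A'x B'x]]]|[[x [Ax A'x]] [y [By B'y]]]].
  by split; [exists (x \o @lshift m n) | exists (x \o @rshift m n)].
have El : fun_join x y \o @lshift m n = x.
  by apply/funext => j; exact: fun_join_lshift.
have Er : fun_join x y \o @rshift m n = y.
  by apply/funext => j; exact: fun_join_rshift.
by exists (fun_join x y); split; split; rewrite ?El ?Er.
Qed.

Lemma set_join_itv m n (a b : 'I_m -> R) (a' b' : 'I_n -> R) :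
  set_join [set x | forall i, x i \in `[a i, b i]]
           [set x | forall i, x i \in `[a' i, b' i]] =
  [set x | forall i, x i \in `[fun_join a a' i, fun_join b b' i]].
Proof.
apply/seteqP; split=> x /=.
  move=> [xl xr] i; rewrite -(splitK i).
  case: (split i) => j /=; first by rewrite !fun_join_lshift; exact: xl.
  by rewrite !fun_join_rshift; exact: xr.
move=> xi; split=> j /=; [move: (xi (lshift n j)) | move: (xi (rshift m j))].
  by rewrite !fun_join_lshift.
by rewrite !fun_join_rshift.
Qed.

Lemma is_box_join m n (A : set ('I_m -> R)) (B : set ('I_n -> R)) :
  is_box A -> is_box B -> is_box (set_join A B).
Proof.
move=> [a [b [ab ->]]] [a' [b' [ab' ->]]].
exists (fun_join a a'), (fun_join b b'); split; last exact: set_join_itv.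
by move=> i; rewrite /fun_join; case: split.
Qed.

Lemma is_cube_join m n (A : set ('I_m -> R)) (B : set ('I_n -> R)) :
  is_cube A -> is_cube B -> is_cube (set_join A B).
Proof.
move=> [a ->] [a' ->]; exists (fun_join a a'); rewrite set_join_itv.
(* Joining commutes with adding 1, so all sides keep unit length. *)
congr [set x | _]; apply/funext => x; apply: eq_forall => i.
by rewrite /fun_join; case: split.
Qed.

End SetJoin.

(* The iterated Cartesian and strong products have equal vertex sets only
   propositionally; the injection s stands for the identity between them. *)
Definition color_split (C S K : sgraph) : Prop :=
  exists (s : C -> S) (c : C -> K),
    [/\ injective s,
        forall u v, (s u == s v) || edge (s u) (s v) -> c u = c v -> u = v &
        forall u v, edge u v = edge (s u) (s v) && edge (c u) (c v)].

(** Induction step: a new factor extends [s] by the identity and [c] by its colouring. *)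
Lemma color_split_product (G C S K : sgraph) (k : nat)
    (col : G -> complete_graph k) :
  (forall x y, edge x y -> col x != col y) ->
  color_split C S K ->
  color_split (cartesian_product G C) (strong_product G S)
              (cartesian_product (complete_graph k) K).
Proof.
move=> colP [s [c [s_inj c_inj eC]]].
exists (fun u => (u.1, s u.2)), (fun u => (col u.1, c u.2)); split.
- by move=> [x y] [x' y'] [-> /s_inj->].
- move=> [x y] [x' y'] /= h [Ecol Ec].
  have {h}[hx hy] : (x == x') || edge x x' /\ (s y == s y') || edge (s y) (s y').
    by case/orP: h => [/eqP[-> ->]|/and3P[_ //]]; rewrite !eqxx.
  rewrite (c_inj _ _ hy Ec); case/orP: hx => [/eqP-> //|/colP].
  by rewrite Ecol eqxx.
- move=> [x y] [x' y'] /=.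
  rewrite /cartesian_edge /strong_edge /= /complete_edge xpair_eqE.
  case: (eqVneq x x') => [<-|xx'] /=.
    rewrite edge_irrefl eqxx /= !orbF eC.
    by case: eqP => //= ->; rewrite edge_irrefl.
  (* For [x != x'] nonadjacent both sides fail. For adjacent ones the colours differ, so adjacency
     on the right needs [c y = c y'], which forces [y = y'] by [c_inj]. *)
  case: (boolP (edge x x')) => //= e.
  have -> : (col x == col x' :> 'I_k) = false := negPf (colP _ _ e).
  rewrite /=.
  apply/eqP/andP => [->|[h /eqP]]; first by rewrite !eqxx.
  exact: c_inj.
Qed.

Lemma color_split_iprod (d : nat) (G : 'I_d -> sgraph) :
  color_split (cartesian_iprod G) (strong_iprod G)
    (cartesian_iprod (fun i => complete_graph (chromatic_number (G i)))).
Proof.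
rewrite /cartesian_iprod /strong_iprod.
apply: (big_rec3 color_split) => [|i C S K _ CSK].
  (* All three empty products are [complete_graph 1]. *)
  by exists id, id; split=> // u v; rewrite andbb.
have [col colP] := chromatic_number_coloring (G i).
exact: (color_split_product colP CSK).
Qed.

Lemma represents_join (R : realType) (C S K : sgraph) (s : C -> S) (c : C -> K)
    (m n : nat) (f : S -> set ('I_m -> R)) (g : K -> set ('I_n -> R)) :
  injective s ->
  (forall u v, (s u == s v) || edge (s u) (s v) -> c u = c v -> u = v) ->
  (forall u v, edge u v = edge (s u) (s v) && edge (c u) (c v)) ->
  represents f -> represents g ->
  represents (fun u => set_join (f (s u)) (g (c u))).
Proof.
move=> s_inj c_inj eC fP gP u v uv; rewrite set_join_meet eC.
have fuv := fP (s u) (s v) (fun e => uv (s_inj _ _ e)).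
(* [c] may identify distinct vertices, about which [g] says nothing; adjacency of [s u] and [s v]
   excludes this. Without that adjacency, [f] already separates the joined sets. *)
have guv (e : edge (s u) (s v)) : edge (c u) (c v) <-> _ :=
  gP (c u) (c v) (fun E => uv (c_inj _ _ (introT orP (or_intror e)) E)).
split=> [/andP[e1 e2]|[/fuv e1 /(guv e1) e2]]; last by rewrite e1.
by split; [exact/fuv | exact/(guv e1)].
Qed.

Theorem theorem3 (R : realType) (d : nat) (G : 'I_d -> sgraph) :
  (boxicity R (cartesian_iprod G) <=
     boxicity R (strong_iprod G) +
     boxicity R (cartesian_iprod (fun i => complete_graph (chromatic_number (G i)))))%N
  /\
  (cubicity R (cartesian_iprod G) <=
     cubicity R (strong_iprod G) +
     cubicity R (cartesian_iprod (fun i => complete_graph (chromatic_number (G i)))))%N.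
Proof.
have [s [c [s_inj c_inj eC]]] := color_split_iprod G.
split; rewrite /boxicity /cubicity;
  (* By minimality of [k], joining optimal representations [f] and [g] into one of dimension [m + n]
     suffices. *)
  case: ex_minnP => k _ kmin; case: ex_minnP => m /asboolP[f [fB fP]] _;
  case: ex_minnP => n /asboolP[g [gB gP]] _; apply/kmin/asboolP;
  exists (fun u => set_join (f (s u)) (g (c u)));
  (split; last exact: represents_join) => u.
  exact: is_box_join.
exact: is_cube_join.
Qed.
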